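(* Let $K$ be a commutative ring with unit, and let $(V_1,G_1)$ and $(V_2,G_2)$ be action type logically Noetherian representations over $K$. Then $(V_1,G_1)$ and $(V_2,G_2)$ are action type geometrically equivalent if and only if $qId_{a.t.}(V_1,G_1)=qId_{a.t.}(V_2,G_2)$.
   Context: A representation $(V,G)$ over $K$ is a group $G$ together with a right $KG$-module $V$ (action written $v\circ g$). A homomorphism of representations $(\alpha,\beta):(V,G)\to(W,H)$ is a $K$-module homomorphism $\alpha:V\to W$ together with a group homomorphism $\beta:G\to H$ such that $(v\circ g)^\alpha=v^\alpha\circ g^\beta$. For finite sets $X,Y$ let $F(Y)$ be the free group on $Y$, $XKF(Y)=\bigoplus_{x\in X}xKF(Y)$ the free right $KF(Y)$-module with basis $X$, and $W(X,Y)=(XKF(Y),F(Y))$. For $T\subset XKF(Y)$ put $T^{\nabla}_{(V,G)}=\{(\alpha,\beta)\in\mathrm{Hom}(W(X,Y),(V,G))\mid \ker\alpha\supset T\}$ and $T^{\nabla\nabla}_{(V,G)}=\bigcap_{(\alpha,\beta)\in T^{\nabla}_{(V,G)}}\ker\alpha$. $(V_1,G_1)$ and $(V_2,G_2)$ are action type geometrically equivalent if $T^{\nabla\nabla}_{(V_1,G_1)}=T^{\nabla\nabla}_{(V_2,G_2)}$ for all finite $X,Y$ and every $T\subset XKF(Y)$. $(V,G)$ is action type logically Noetherian if for all finite $X,Y$, every $T\subset XKF(Y)$ and every $w\in T^{\nabla\nabla}_{(V,G)}$ there is a finite $T_0\subset T$ with $w\in(T_0)^{\nabla\nabla}_{(V,G)}$.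 An action type quasi-identity is a formula $\left(\bigwedge_{i=1}^n(w_i=0)\right)\Rightarrow(w_0=0)$ with $w_0,\dots,w_n\in XKF(Y)$, $X,Y$ finite; $(V,G)$ satisfies it if $w_0^\alpha=0$ for every $(\alpha,\beta)\in\mathrm{Hom}(W(X,Y),(V,G))$ with $w_i^\alpha=0$ for $i=1,\dots,n$. $qId_{a.t.}(V,G)$ is the set of all action type quasi-identities satisfied by $(V,G)$. *)

(* Defs.v *)
From HB Require Import structures.
From mathcomp Require Import all_boot all_algebra.
From mathcomp Require Import finmap monalg.
From mathcomp Require Import boolp classical_sets cardinality.

Set Implicit Arguments.
Unset Strict Implicit.
Unset Printing Implicit Defensive.

Import GRing.Theory.
Local Open Scope ring_scope.
Local Open Scope classical_set_scope.

(* A letter (y, false) stands for y and (y, true) for y^-1.  The free group   *)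
(* F(Y) is the set of reduced words, multiplied by concatenation followed by  *)
(* free cancellation.                                                         *)
Section FreeGroup.
Variable Y : finType.
Implicit Types (a b : Y * bool) (s t u : seq (Y * bool)).

Definition letter_inv a : Y * bool := (a.1, ~~ a.2).

Definition reduced s : bool := sorted (fun a b => b != letter_inv a) s.

Definition word_push a s : seq (Y * bool) :=
  if s is b :: s' then if b == letter_inv a then s' else a :: s else [:: a].

Definition word_mul s t : seq (Y * bool) := foldr word_push t s.

Definition word_inv s : seq (Y * bool) := rev (map letter_inv s).

Lemma letter_invK : involutive letter_inv.
Proof. by case=> y b; rewrite /letter_inv /= negbK. Qed.

Lemma word_push_reduced a s : reduced s -> reduced (word_push a s).
Proof.
case: s => [|b s] //=; case: ifPn => [_ | ab]; first exact: path_sorted.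
by rewrite /reduced /= ab.
Qed.

Lemma word_mul_reduced s t : reduced t -> reduced (word_mul s t).
Proof. by move=> tP; elim: s => //= a s; apply: word_push_reduced. Qed.

Lemma word_inv_reduced s : reduced s -> reduced (word_inv s).
Proof.
rewrite /word_inv /reduced rev_sorted sorted_map; apply: sub_sorted => a b.
by apply: contraNN => /eqP; rewrite letter_invK => <-.
Qed.

Lemma word_pushK a s : reduced s -> word_push a (word_push (letter_inv a) s) = s.
Proof.
case: s => [|b s] /=; first by rewrite eqxx.
rewrite letter_invK; case: (eqVneq b a) => [-> | _ _] /=; last by rewrite eqxx.
by case: s => [|c s] //= /andP[/negPf->].
Qed.

Lemma word_mul_push a s t : reduced s -> reduced t ->
  word_mul (word_push a s) t = word_push a (word_mul s t).
Proof.
case: s => [|b s] //= sP tP; case: eqP => //= ->.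
by rewrite word_pushK // word_mul_reduced.
Qed.

Lemma word_mulA s t u : reduced t -> reduced u ->
  word_mul s (word_mul t u) = word_mul (word_mul s t) u.
Proof.
move=> tP uP; elim: s => //= a s ->.
by rewrite word_mul_push // word_mul_reduced.
Qed.

Lemma word_mul_nil s : reduced s -> word_mul s [::] = s.
Proof.
elim: s => //= a s IHs asP; rewrite IHs; last exact: path_sorted asP.
by case: s asP {IHs} => [|b s] //= /andP[/negPf->].
Qed.

Lemma word_mulVs s : word_mul (word_inv s) s = [::].
Proof.
rewrite /word_mul /word_inv; elim: s => //= a s IHs.
by rewrite rev_cons foldr_rcons /= letter_invK eqxx.
Qed.

Lemma word_invK : involutive word_inv.
Proof. by move=> s; rewrite /word_inv map_rev revK mapK //; apply: letter_invK. Qed.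

Lemma word_mulsV s : word_mul s (word_inv s) = [::].
Proof. by rewrite -[s in word_mul s _]word_invK word_mulVs. Qed.

Record free_group := FreeGroup { fg_word : seq (Y * bool); _ : reduced fg_word }.
HB.instance Definition _ := [isSub for fg_word].
HB.instance Definition _ := [Choice of free_group by <:].

Definition fg_one : free_group := @FreeGroup [::] isT.
Definition fg_mul (x y : free_group) : free_group :=
  FreeGroup (word_mul_reduced (val x) (valP y)).
Definition fg_inv (x : free_group) : free_group :=
  FreeGroup (word_inv_reduced (valP x)).

Lemma fg_mulA : associative fg_mul.
Proof. by move=> x y z; apply: val_inj; rewrite /= word_mulA ?(valP y) ?(valP z). Qed.
Lemma fg_mul1 : left_id fg_one fg_mul.
Proof. by move=> x; apply: val_inj. Qed.
Lemma fg_mulr1 : right_id fg_one fg_mul.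
Proof. by move=> x; apply: val_inj; rewrite /= word_mul_nil ?(valP x). Qed.
Lemma fg_mulV : left_inverse fg_one fg_inv fg_mul.
Proof. by move=> x; apply: val_inj; rewrite /= word_mulVs. Qed.
Lemma fg_mulrV : right_inverse fg_one fg_inv fg_mul.
Proof. by move=> x; apply: val_inj; rewrite /= word_mulsV. Qed.

HB.instance Definition _ :=
  isGroup.Build free_group fg_mulA fg_mul1 fg_mulr1 fg_mulV fg_mulrV.

End FreeGroup.

(* The group algebra KG, carried by the finitely supported functions G -> K.  *)
(* The library only makes {malg K[M]} a ring when M is a monomType, which     *)
(* excludes nontrivial groups.                                                *)
Definition group_algebra (K : pzRingType) (G : groupType) := {malg K[G]}.

Section GroupAlgebra.
Variables (K : pzRingType) (G : groupType).
Local Notation KG := (group_algebra K G).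
Implicit Types (x y z : KG) (d : {fset G}).

HB.instance Definition _ := GRing.Zmodule.on KG.

Definition ga_one : KG := << 1 *g 1%g >>.

Definition ga_mul x y : KG :=
  \sum_(g <- msupp x) \sum_(h <- msupp y) << x@_g * y@_h *g (g * h)%g >>.

Lemma ga_mulw d1 d2 x y :
    (msupp x `<=` d1)%fset -> (msupp y `<=` d2)%fset ->
  ga_mul x y = \sum_(g <- d1) \sum_(h <- d2) << x@_g * y@_h *g (g * h)%g >>.
Proof.
move=> le_d1 le_d2; rewrite /ga_mul (big_fset_incl _ le_d1) /=.
  apply/eq_bigr=> g _; apply/big_fset_incl => // h _ /mcoeff_outdom ->.
  by rewrite mulr0 monalgU0.
move=> g _ /mcoeff_outdom xg.
by rewrite big1 => // h _; rewrite xg mul0r monalgU0.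
Qed.

Lemma ga_mulDl : left_distributive ga_mul +%R.
Proof.
move=> x y z; pose d := (msupp x `|` msupp y)%fset.
rewrite (@ga_mulw d (msupp z) (x + y)) ?msuppD_le //.
rewrite (@ga_mulw d (msupp z) x) ?fsubsetUl //.
rewrite (@ga_mulw d (msupp z) y) ?fsubsetUr //.
rewrite -big_split /=; apply/eq_bigr=> g _.
rewrite -big_split /=; apply/eq_bigr=> h _.
by rewrite mcoeffD mulrDl monalgUD.
Qed.

Lemma ga_mulDr : right_distributive ga_mul +%R.
Proof.
move=> z x y; pose d := (msupp x `|` msupp y)%fset.
rewrite (@ga_mulw (msupp z) d z (x + y)) ?msuppD_le //.
rewrite (@ga_mulw (msupp z) d z x) ?fsubsetUl //.
rewrite (@ga_mulw (msupp z) d z y) ?fsubsetUr //.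
rewrite -big_split /=; apply/eq_bigr=> g _.
rewrite -big_split /=; apply/eq_bigr=> h _.
by rewrite mcoeffD mulrDr monalgUD.
Qed.

Lemma ga_mul0 : left_zero 0 ga_mul.
Proof. by move=> x; rewrite /ga_mul msupp0 big_seq_fset0. Qed.

Lemma ga_mulr0 : right_zero 0 ga_mul.
Proof. by move=> x; rewrite /ga_mul big1 // => g _; rewrite msupp0 big_seq_fset0. Qed.

Lemma ga_mulUU (a b : K) (g h : G) :
  ga_mul << a *g g >> << b *g h >> = << a * b *g (g * h)%g >>.
Proof.
by rewrite (ga_mulw (@msuppU_le _ _ _ _) (@msuppU_le _ _ _ _)) !big_seq_fset1 !mcoeffUU.
Qed.

Lemma ga_ind (P : KG -> Prop) :
    P 0 -> (forall x y, P x -> P y -> P (x + y)) ->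
    (forall a g, P << a *g g >>) ->
  forall x, P x.
Proof. by move=> P0 PD PU x; rewrite [x]monalgE; apply: big_ind. Qed.

Lemma ga_mulA : associative ga_mul.
Proof.
move=> x y z; elim/ga_ind: x => [|x x' IH IH'|a g]; first by rewrite !ga_mul0.
  by rewrite !ga_mulDl IH IH'.
elim/ga_ind: y => [|y y' IH IH'|b h]; first by rewrite !(ga_mul0, ga_mulr0).
  by rewrite !(ga_mulDl, ga_mulDr) IH IH'.
elim/ga_ind: z => [|z z' IH IH'|c k]; first by rewrite !ga_mulr0.
  by rewrite !ga_mulDr IH IH'.
by rewrite !ga_mulUU mulrA mulgA.
Qed.

Lemma ga_mul1 : left_id ga_one ga_mul.
Proof.
elim/ga_ind=> [|x y IHx IHy|a g]; first by rewrite ga_mulr0.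
  by rewrite ga_mulDr IHx IHy.
by rewrite ga_mulUU mul1r mul1g.
Qed.

Lemma ga_mulr1 : right_id ga_one ga_mul.
Proof.
elim/ga_ind=> [|x y IHx IHy|a g]; first by rewrite ga_mul0.
  by rewrite ga_mulDl IHx IHy.
by rewrite ga_mulUU mulr1 mulg1.
Qed.

HB.instance Definition _ := GRing.Zmodule_isPzRing.Build KG
  ga_mulA ga_mul1 ga_mulr1 ga_mulDl ga_mulDr.

Definition ga_scalar (a : K) : KG := << a *g 1%g >>.
Definition ga_group (g : G) : KG := << 1 *g g >>.

End GroupAlgebra.

(* Right KG-modules are left modules over the converse ring KG^c, so for      *)
(* (V, G) below v \circ g is (ga_group K g : KG^c) *: v.                      *)
Record representation (K : comPzRingType) := Representation {
  rep_group : groupType;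
  rep_module : lmodType (group_algebra K rep_group)^c
}.

Definition rep_act (K : comPzRingType) (R : representation K)
    (v : rep_module R) (g : rep_group R) : rep_module R :=
  (ga_group K g : (group_algebra K (rep_group R))^c) *: v.

(* The module of a representation, with its scalars restricted from KG to K.  *)
Definition rep_Kmodule (K : comPzRingType) (R : representation K) : Type :=
  rep_module R.

Section RestrictScalars.
Variables (K : comPzRingType) (R : representation K).
Local Notation G := (rep_group R).
Local Notation KG := (group_algebra K G).
Implicit Types (a b : K) (v : rep_module R).

HB.instance Definition _ :=
  GRing.Zmodule.copy (rep_Kmodule R) (rep_module R).

Definition rep_scale a v : rep_module R := (ga_scalar G a : KG^c) *: v.

Lemma rep_scaleA a b v : rep_scale a (rep_scale b v) = rep_scale (a * b) v.
Proof.
rewrite /rep_scale scalerA; congr (_ *: v).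
by rewrite [LHS](@ga_mulUU K G) mulrC mul1g.
Qed.

Lemma rep_scale1 : left_id 1 rep_scale.
Proof. exact: scale1r. Qed.

Lemma rep_scaleDr : right_distributive rep_scale +%R.
Proof. by move=> a u v; apply: scalerDr. Qed.

Lemma rep_scaleDl v : {morph rep_scale^~ v : a b / a + b}.
Proof. by move=> a b; rewrite /rep_scale /ga_scalar monalgUD scalerDl. Qed.

HB.instance Definition _ := GRing.Zmodule_isLmodule.Build K (rep_Kmodule R)
  rep_scaleA rep_scale1 rep_scaleDr rep_scaleDl.

End RestrictScalars.

(* Multiplicative maps between groups preserve 1 and inverses.                *)
Record rep_hom (K : comPzRingType) (R S : representation K) := RepHom {
  hom_module : {linear rep_Kmodule R -> rep_Kmodule S};
  hom_group : {multiplicative rep_group R -> rep_group S};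
  _ : forall (v : rep_module R) (g : rep_group R),
        hom_module (rep_act v g) = rep_act (hom_module v : rep_module S) (hom_group g)
}.

(* W(X, Y) = (XKF(Y), F(Y)).  XKF(Y) is the direct sum of copies of KF(Y)     *)
(* indexed by X; under ((KF(Y))^c)^o the ring KF(Y) acts on itself by right   *)
(* multiplication.                                                            *)
Definition free_rep (K : comPzRingType) (X Y : finType) : representation K :=
  @Representation K (free_group Y)
    {ffun X -> ((group_algebra K (free_group Y))^c)^o}.

Definition free_module (K : comPzRingType) (X Y : finType) :=
  rep_module (free_rep K X Y).

Section ActionType.
Variable K : comPzRingType.
Implicit Types (R : representation K) (X Y : finType).

Definition hom_ker R S (h : rep_hom R S) : set (rep_module R) :=
  [set v | hom_module h v = 0].

Definition nabla R X Y (T : set (free_module K X Y)) :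
    set (rep_hom (free_rep K X Y) R) :=
  [set h | T `<=` hom_ker h].
Arguments nabla R {X Y} T.

Definition nabla2 R X Y (T : set (free_module K X Y)) : set (free_module K X Y) :=
  \bigcap_(h in nabla R T) hom_ker h.
Arguments nabla2 R {X Y} T.

Definition at_geometrically_equivalent R1 R2 : Prop :=
  forall X Y (T : set (free_module K X Y)), nabla2 R1 T = nabla2 R2 T.

Definition at_logically_noetherian R : Prop :=
  forall X Y (T : set (free_module K X Y)) (w : free_module K X Y),
    nabla2 R T w ->
    exists T0 : set (free_module K X Y),
      [/\ T0 `<=` T, finite_set T0 & nabla2 R T0 w].

(* The formula (/\_(w <- qi_premises) (w = 0)) => (qi_conclusion = 0).        *)
Record at_quasi_identity := AtQuasiIdentity {
  qi_X : finType;
  qi_Y : finType;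
  qi_premises : seq (free_module K qi_X qi_Y);
  qi_conclusion : free_module K qi_X qi_Y
}.

Definition at_satisfies R (q : at_quasi_identity) : Prop :=
  forall h : rep_hom (free_rep K (qi_X q) (qi_Y q)) R,
    (forall w, w \in qi_premises q -> hom_module h w = 0) ->
    hom_module h (qi_conclusion q) = 0.

(* A subset of at_quasi_identity, written as a predicate: the type of         *)
(* quasi-identities is too large a universe for classical_sets.set.           *)
Definition qId_at R : at_quasi_identity -> Prop := fun q => at_satisfies R q.

End ActionType.

(* Main.v *)
Require Import Defs.
From mathcomp Require Import all_boot all_algebra.
From mathcomp Require Import boolp classical_sets cardinality.

Set Implicit Arguments.
Unset Strict Implicit.
Unset Printing Implicit Defensive.

Local Open Scope classical_set_scope.

(** A quasi-identity with premises [s] and conclusion [w] holds in [R] exactly when [w] lies in the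
    closure [nabla2] of the finite set listed by [s]. So the quasi-identities of [R] record
    precisely its closures of finite sets, and equivalent representations share them. Conversely,
    the Noetherian condition makes every closure the union of the closures of finite subsets, so
    finite closures determine all of them. *)

Section NablaClosure.
Variable K : comPzRingType.
Implicit Types (R : representation K) (X Y : finType).

Lemma nabla2_mono R X Y (T0 T : set (free_module K X Y)) :
  T0 `<=` T -> nabla2 R T0 `<=` nabla2 R T.
Proof. by move=> T0T w T0w h hT; apply: T0w; apply: subset_trans hT. Qed.

(** Both sides unfold to the same statement about homomorphisms killing [s]. *)
Lemma nabla2_satisfies R X Y (s : seq (free_module K X Y)) (w : free_module K X Y) :
  nabla2 R [set` s] w <-> at_satisfies R (AtQuasiIdentity s w).
Proof. by []. Qed.

(** One inclusion only: equality of closures follows by exchanging [R1] and [R2]. *)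
Lemma nabla2_sub_qId R1 R2 X Y (T : set (free_module K X Y)) :
    at_logically_noetherian R1 -> (forall q, qId_at R1 q -> qId_at R2 q) ->
  nabla2 R1 T `<=` nabla2 R2 T.
Proof.
move=> noeth1 qId12 w /noeth1[T0 [T0T /finite_seqP[s T0s] T0w]].
(* It suffices to reach the closure of the finite [T0] in [R2]; listed as [s], it supplies the
   premises of a quasi-identity true in [R1]. *)
apply: (nabla2_mono T0T); rewrite T0s in T0w *.
exact/nabla2_satisfies/qId12/nabla2_satisfies.
Qed.

Lemma qId_of_geometrically_equivalent R1 R2 :
  at_geometrically_equivalent R1 R2 -> qId_at R1 = qId_at R2.
Proof.
move=> eqv; apply/funext => -[X Y s w]; apply/propext.
by rewrite /qId_at -!nabla2_satisfies eqv.
Qed.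

End NablaClosure.

Theorem theorem6p1 (K : comPzRingType) (R1 R2 : representation K)
    (noeth1 : at_logically_noetherian R1) (noeth2 : at_logically_noetherian R2) :
  at_geometrically_equivalent R1 R2 <-> qId_at R1 = qId_at R2.
Proof.
split=> [|eqId X Y T]; first exact: qId_of_geometrically_equivalent.
by apply/seteqP; split; apply: nabla2_sub_qId => // q; rewrite eqId.
Qed.
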